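(* Let $\mathbb{F}$ be a field of characteristic zero and let $k,n_1,\dots,n_k\ge 1$ be integers. The following are equivalent for an additive surjection $$\Phi\colon M_{n_1}(\mathbb{F})\oplus\dots\oplus M_{n_k}(\mathbb{F})\to M_{n_1}(\mathbb{F})\oplus\dots\oplus M_{n_k}(\mathbb{F}).$$ (i) $\Phi$ maps singular elements into singular elements. (ii) There exists a permutation of blocks $\pi$, which respects their dimension, such that $\Phi(M_{n_i}(\mathbb{F}))=\pi(M_{n_i}(\mathbb{F}))$ for every $i=1,\dots,k$. Moreover, for every $i$ with $n_i\ge2$ there exist a field endomorphism $\sigma_i\colon\mathbb{F}\to\mathbb{F}$ and invertible matrices $P_i,Q_i\in M_{n_i}(\mathbb{F})$ such that either $$\Phi(A_i)= P_i\,\pi(A_i)^{\sigma_i}\, Q_i\quad\text{for all } A_i\in M_{n_i}(\mathbb{F}),$$ or $$\Phi(A_i)= P_i\,\pi(A_i^T)^{\sigma_i}\, Q_i\quad\text{for all } A_i\in M_{n_i}(\mathbb{F}).$$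
   Context: An element of $\mathcal{A}=\bigoplus_{i=1}^k M_{n_i}(\mathbb{F})$ is singular if it is not invertible in $\mathcal{A}$ (equivalently, at least one of its blocks is a non-invertible matrix). Each $M_{n_i}(\mathbb{F})$ is identified with the $i$-th block (direct summand) of $\mathcal{A}$. A permutation $\pi$ of $\{1,\dots,k\}$ with $n_{\pi(i)}=n_i$ for all $i$ (a permutation of blocks respecting their dimension) induces the linear bijection of $\mathcal{A}$, again denoted $\pi$, given by $\bigoplus A_i\mapsto\bigoplus A_{\pi(i)}$; thus for $A_i$ in the $i$-th block, $\pi(A_i)$ is the same matrix placed in the block of the same size to which $\pi$ moves the $i$-th block, and the products with $P_i,Q_i$ are taken inside that block. For a matrix $A$ and a field endomorphism $\sigma$, $A^{\sigma}$ is the matrix obtained by applying $\sigma$ to every entry of $A$; $A^T$ is the transpose. *)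

(* Defs.v *)
From HB Require Import structures.
From mathcomp Require Import all_boot all_order all_fingroup all_algebra.

Set Implicit Arguments.
Unset Strict Implicit.
Unset Printing Implicit Defensive.

Import GRing.Theory.
Local Open Scope ring_scope.

Definition block_alg (F : fieldType) (k : nat) (n : 'I_k -> nat) : Type :=
  {dffun forall i : 'I_k, 'M[F]_(n i)}.

Section BlockAlgRing.
Variables (F : fieldType) (k : nat) (n : 'I_k -> nat).
Local Notation A := (block_alg F n).
Implicit Types x y z : A.

HB.instance Definition _ := Choice.copy A {dffun forall i : 'I_k, 'M[F]_(n i)}.

Definition block_zero : A := [ffun i => 0 : 'M[F]_(n i)].
Definition block_opp x : A := [ffun i => - x i : 'M[F]_(n i)].
Definition block_add x y : A := [ffun i => x i + y i : 'M[F]_(n i)].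
Definition block_one : A := [ffun i => 1%:M : 'M[F]_(n i)].
Definition block_mul x y : A := [ffun i => x i *m y i : 'M[F]_(n i)].

Fact block_addA : associative block_add.
Proof. by move=> x y z; apply/ffunP=> i; rewrite !ffunE addrA. Qed.
Fact block_addC : commutative block_add.
Proof. by move=> x y; apply/ffunP=> i; rewrite !ffunE addrC. Qed.
Fact block_add0 : left_id block_zero block_add.
Proof. by move=> x; apply/ffunP=> i; rewrite !ffunE add0r. Qed.
Fact block_addN : left_inverse block_zero block_opp block_add.
Proof. by move=> x; apply/ffunP=> i; rewrite !ffunE addNr. Qed.

HB.instance Definition _ :=
  GRing.isZmodule.Build A block_addA block_addC block_add0 block_addN.

Fact block_mulA : associative block_mul.
Proof. by move=> x y z; apply/ffunP=> i; rewrite !ffunE mulmxA. Qed.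
Fact block_mul1l : left_id block_one block_mul.
Proof. by move=> x; apply/ffunP=> i; rewrite !ffunE mul1mx. Qed.
Fact block_mul1r : right_id block_one block_mul.
Proof. by move=> x; apply/ffunP=> i; rewrite !ffunE mulmx1. Qed.
Fact block_mulDl : left_distributive block_mul +%R.
Proof. by move=> x y z; apply/ffunP=> i; rewrite !ffunE mulmxDl. Qed.
Fact block_mulDr : right_distributive block_mul +%R.
Proof. by move=> x y z; apply/ffunP=> i; rewrite !ffunE mulmxDr. Qed.

HB.instance Definition _ :=
  GRing.Zmodule_isPzRing.Build A
    block_mulA block_mul1l block_mul1r block_mulDl block_mulDr.

End BlockAlgRing.

Section BlockOps.
Variables (F : fieldType) (k : nat) (n : 'I_k -> nat).
Local Notation A := (block_alg F n).

Definition singular (x : A) : Prop :=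
  ~ exists y : A, x * y = 1 /\ y * x = 1.

(* The embedding of M_(n i)(F) as the i-th direct summand. *)
Definition in_block (i : 'I_k) (M : 'M[F]_(n i)) : A :=
  [ffun j => dfwith (fun j => 0 : 'M[F]_(n j)) M j].

Definition is_block (i : 'I_k) (x : A) : Prop :=
  exists M : 'M[F]_(n i), x = in_block M.

(* The map sending (+)_i x_i to (+)_i x_(p i); it moves the i-th summand to
   the summand of index p^-1 i. *)
Definition block_perm (p : 'S_k) (np : forall i, n (p i) = n i) (x : A) : A :=
  [ffun i => castmx (np i, np i) (x (p i))].

Definition block_map (s : {rmorphism F -> F}) (x : A) : A :=
  [ffun i => map_mx s (x i)].

End BlockOps.

(* Main.v *)
Require Import Defs.
From HB Require Import structures.
From mathcomp Require Import all_boot all_order all_fingroup all_algebra.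
From Stdlib Require Import Classical.

Set Implicit Arguments.
Unset Strict Implicit.
Unset Printing Implicit Defensive.

Import GRing.Theory.
Local Open Scope ring_scope.

(** The implication from the block form to the preservation of singularity is a
    computation of determinants.  For the converse, everything rests on the
    following fact about an additive group [V] of singular [m] x [m] matrices
    over a field of characteristic zero.  The [F]-span of [V] is still singular
    (lemma [singular_span]: a polynomial vanishing at all positive integers is
    zero), so that, by a theorem of Dieudonne (lemma [singular_space]), [V] lies
    in a subspace of codimension at least [m]; if this span has codimension
    exactly [m], its elements have a common kernel vector on one side.

    For a nonzero column [u] of size [n i], let [K u] be the group of the
    elements [x] with [x i *m u = 0].  It consists of singular elements, hence
    so does its image by [Phi], and since a product of nonzero polynomials does
    not vanish at all positive integers, there is a single block [j] in which
    all elements of this image are singular (lemma [singular_group_block]).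
    Choose a basis of columns in every block: the groups [K u] so obtained
    are in general position, and since [Phi] is surjective the codimensions of
    the subspaces of the block [j] containing their images add up (lemma
    [codim_sum]).  At most [n j] of them can therefore have the target [j].  As there are as many columns as the sum of
    the [n j], there are exactly [n j] of them, and equality holds in every
    estimate (lemma [target_count]).  Replacing one column of a basis by
    its sum with another column of the same block must not alter this count, so
    that all columns of a block have the same target (lemma
    [target_exchange]).  This yields the permutation of blocks, and the
    vanishing of [Phi x j] when [x (p j) = 0] (lemma [block_structure]).

    There remains an additive surjection [f] of a single matrix algebra mapping
    singular matrices to singular matrices (lemma [singularity_preserver]).  By
    the equality case of the count, for each nonzero column [u], the matrices
    [f x] with [x *m u = 0] have a common kernel vector, on the right or on the
    left; surjectivity of [f] forces the side to be independent of [u], and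
    transposition reduces to kernel vectors on the right.  Applied to the
    standard basis and to the sum of its vectors, this shows that, up to right
    multiplication by an invertible matrix, [f] applies one and the same
    additive map [g] to each column.  Applied to the sum of the first basis
    vector and of [l] times the second one, it shows that [g (l *: y)] is
    proportional to [g y] by a factor that depends on [l] only; this factor is
    the required field endomorphism. *)

(** * Additive groups of singular matrices *)

(** [P] is the membership predicate of an additive subgroup of [V]. *)
Definition subgroup_pred (V : zmodType) (P : V -> Prop) : Prop :=
  P 0 /\ forall x y, P x -> P y -> P (x - y).

Lemma subgroup_predD (V : zmodType) (P : V -> Prop) x y :
  subgroup_pred P -> P x -> P y -> P (x + y).
Proof.
move=> [P0 PB] Px Py; rewrite -[y]opprK; apply: (PB) => //.
by rewrite -[- y]add0r; apply: (PB).
Qed.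

Lemma subgroup_predMn (V : zmodType) (P : V -> Prop) x m :
  subgroup_pred P -> P x -> P (x *+ m).
Proof.
move=> gP Px; elim: m => [|m IHm]; first by rewrite mulr0n; case: gP.
by rewrite mulrS; apply: subgroup_predD.
Qed.

Section Pencils.
Variable F : fieldType.
Hypothesis charF : [pchar F] =i pred0.

Lemma poly0_of_nat_roots (q : {poly F}) :
  (forall t : nat, (0 < t)%N -> q.[t%:R] = 0) -> q = 0.
Proof.
move=> q0; apply/eqP/negPn/negP => nzq.
pose s := [seq (t%:R : F) | t <- iota 1 (size q)].
have us : uniq s.
  rewrite map_inj_uniq ?iota_uniq // => a b.
  wlog le_ab : a b / (a <= b)%N.
    by move=> H; case: (leqP a b) => [/H //|/ltnW /H h] e; apply/esym/h.
  move=> e; apply/eqP; rewrite eqn_leq le_ab -subn_eq0.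
  have /pcharf0P <- := charF.
  by rewrite natrB // e subrr eqxx.
have: (size s < size q)%N.
  apply: (max_poly_roots nzq) => //; apply/allP => x /mapP [t]; rewrite mem_iota.
  by case/andP => t0 _ ->; apply/rootP/q0.
by rewrite size_map size_iota ltnn.
Qed.

Lemma nat_nonroot (q : {poly F}) :
  q != 0 -> exists2 t : nat, (0 < t)%N & q.[t%:R] != 0.
Proof.
move=> nzq; apply: NNPP => H; case/eqP: nzq; apply: poly0_of_nat_roots => t t0.
by apply/eqP/negPn/negP => qt; apply: H; exists t.
Qed.

(** The determinant of a pencil is a polynomial function of the parameter. *)
Lemma det_pencil m (X Y : 'M[F]_m) :
  exists q : {poly F}, forall t, q.[t] = \det (X + t *: Y).
Proof.
exists (\det (map_mx polyC X + 'X *: map_mx polyC Y)) => t.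
rewrite -[LHS]/(horner_eval t _) -det_map_mx; congr (\det _).
by apply/matrixP => i j; rewrite !mxE -[LHS]/(_.[t]) !hornerE.
Qed.

(** A pencil of matrices that is singular at all positive integers is singular
    everywhere. *)
Lemma det_pencil0 m (X Y : 'M[F]_m) :
  (forall t : nat, (0 < t)%N -> \det (X + t%:R *: Y) = 0) ->
  forall t : F, \det (X + t *: Y) = 0.
Proof.
have [q qE] := det_pencil X Y => H t; rewrite -qE.
by rewrite (@poly0_of_nat_roots q) ?horner0 // => u u0; rewrite qE H.
Qed.

(** In characteristic zero, the linear span of an additive group of singular
    matrices still consists of singular matrices. *)
Lemma singular_span m (P : 'M[F]_m -> Prop) :
  subgroup_pred P -> (forall x, P x -> \det x = 0) ->
  exists U : {vspace 'M[F]_m},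
    (forall x, P x -> x \in U) /\ (forall x, x \in U -> \det x = 0).
Proof.
move=> gP Ps.
(* A subspace U such that every element of U + P is singular can be enlarged
   by any element of P. *)
have [U [PU Us]] : exists U : {vspace 'M[F]_m}, (forall x, P x -> x \in U) /\
    forall x y, x \in U -> P y -> \det (x + y) = 0; last first.
  exists U; split=> // x xU; rewrite -[x]addr0; apply: Us => //; by case: gP.
have: forall x y, x \in (0%VS : {vspace 'M[F]_m}) -> P y -> \det (x + y) = 0.
  by move=> x y; rewrite memv0 => /eqP -> Py; rewrite add0r Ps.
move: (0%VS) => U.
have [d] := ubnP (dim 'M[F]_m - \dim U)%N.
elim: d U => // d IHd U; rewrite ltnS => leUd Us.
case: (classic (exists2 x, P x & x \notin U)) => [[p Pp pU]|H]; last first.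
  exists U; split=> // x Px; apply/negPn/negP => xU; apply: H; by exists x.
apply: (IHd (U + <[p]>)%VS).
  have ltU : (\dim U < \dim (U + <[p]>))%N.
    rewrite (ltn_leqif (dimv_leqif_sup (addvSl _ _))).
    apply: contra pU => /subvP; apply.
    exact: subvP (addvSr _ _) _ (memv_line _).
  apply: leq_trans leUd; apply: ltn_sub2l => //; apply: leq_trans ltU _.
  by rewrite -dimvf dimvS ?subvf.
move=> x y /memv_addP [u uU [v /vlineP [t ->] ->]] Py.
rewrite -addrA addrCA addrC; apply: det_pencil0 => {}t _.
rewrite -addrA; apply: Us => //; apply: subgroup_predD => //.
by rewrite scaler_nat; apply: subgroup_predMn.
Qed.

End Pencils.

(** * Linear spaces of singular matrices *)

Section Dieudonne.
Variable F : fieldType.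
Hypothesis charF : [pchar F] =i pred0.

(** A subspace that is totally isotropic for a nondegenerate bilinear form has
    at most half of the dimension. *)
Lemma isotropic_dim N (M : 'M[F]_N) (W : {vspace 'rV[F]_N}) :
  M \in unitmx -> (forall w w', w \in W -> w' \in W -> w *m M *m w'^T = 0) ->
  (\dim W + \dim W <= N)%N.
Proof.
move=> uM iW; pose X := \matrix_(i < \dim W) (vbasis W)`_i.
have rX : \rank X = \dim W.
  apply/eqP; rewrite -[_ == _]/(row_free X) -kermx_eq0; apply/rowV0P => v.
  move=> /sub_kermxP vX0.
  have /freeP fr := basis_free (vbasisP W).
  apply/rowP => i; rewrite [RHS]mxE; move: i; apply: (fr (v 0)).
  rewrite -[RHS]vX0 mulmx_sum_row; apply: eq_bigr => i _.
  by rewrite rowK.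
have XW i : row i X \in W by rewrite rowK vbasis_mem // mem_nth // size_tuple.
have XMX : X *m M *m X^T = 0.
  apply/matrixP => i j; have /matrixP/(_ 0 0) := iW _ _ (XW i) (XW j).
  by rewrite -row_mul tr_row colE mulmxA -colE -row_mul !mxE.
have := mulmx0_rank_max XMX.
by rewrite mxrank_tr mxrankMfree ?row_free_unit // rX.
Qed.

Section OffDiagonal.
Variable m : nat.

(** The two off-diagonal blocks of a matrix split along its first row and first
    column, as a single row. *)
Definition off_diag (x : 'M[F]_(1 + m)) : 'rV[F]_(m + m) :=
  row_mx (ursubmx x) (dlsubmx x)^T.

Fact off_diag_is_linear : linear off_diag.
Proof.
move=> a x y; rewrite /off_diag /ursubmx /dlsubmx !linearP /=.
by rewrite scale_row_mx add_row_mx.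
Qed.
HB.instance Definition _ :=
  GRing.isLinear.Build F 'M[F]_(1 + m) 'rV[F]_(m + m) _ off_diag
    off_diag_is_linear.

(** [x] bordered by a zero row above and a zero column on the left. *)
Definition corner (x : 'M[F]_m) : 'M[F]_(1 + m) := block_mx 0 0 0 x.

Fact corner_is_linear : linear corner.
Proof.
by move=> a x y; rewrite /corner scale_block_mx add_block_mx !scaler0 !addr0.
Qed.
HB.instance Definition _ :=
  GRing.isLinear.Build F 'M[F]_m 'M[F]_(1 + m) _ corner corner_is_linear.

Lemma det_border1 (C : 'rV[F]_m) (B : 'cV[F]_m) :
  \det (block_mx 0 C B 1%:M) = - (C *m B) 0 0.
Proof.
have e : block_mx 0 C B 1%:M *m block_mx 1%:M 0 (- B) 1%:M
   = block_mx (- (C *m B)) C 0 1%:M.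
  by rewrite mulmx_block !(mulmx0, mul0mx, mulmx1, mul1mx, add0r, addr0)
       mulmxN subrr.
have := congr1 (fun A => \det A) e.
rewrite det_mulmx det_lblock det_ublock !det1 !mulr1 => ->.
by rewrite det_mx11 mxE.
Qed.

End OffDiagonal.

(** Dieudonne's theorem for a space [U] of singular matrices containing an
    element of corank one, here normalized to [corner 1%:M].  If [x] in [U] has
    the blocks [d], [C], [B], [A], the determinants of [x] plus multiples of
    [corner 1%:M] give [d = 0] and then [C *m B = 0]. *)
Section Bordered.
Variables (m : nat) (U : {vspace 'M[F]_(1 + m)}).
Hypothesis Us : forall x, x \in U -> \det x = 0.
Hypothesis UJ : corner 1%:M \in U.

Let scaled_row (x : 'M[F]_(1 + m)) (t : F) : t != 0 -> x \in U ->
  \det (block_mx 1%:M 0 0 (t%:M) *m (x + t^-1 *: corner 1%:M)) = 0.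
Proof.
by move=> t0 xU; rewrite det_mulmx [X in _ * X]Us ?mulr0 // memvD ?memvZ.
Qed.

Lemma border_corner0 x : x \in U -> ulsubmx x = 0.
Proof.
move=> xU.
have /(_ 0) : forall t, \det (block_mx (ulsubmx x) (ursubmx x) 0 1%:M +
   t *: block_mx 0 0 (dlsubmx x) (drsubmx x)) = 0.
  apply: det_pencil0 => // t t0.
  have nt0 : t%:R != 0 :> F by have /pcharf0P -> := charF; rewrite -lt0n.
  rewrite -[RHS](scaled_row nt0 xU); congr (\det _).
  rewrite -[X in _ *m (X + _)]submxK /corner !scale_block_mx !add_block_mx.
  rewrite mulmx_block.
  rewrite !(mulmx0, mul0mx, mul1mx, addr0, add0r, scaler0) !mul_scalar_mx.
  by rewrite scalerDr scalerA divff // scale1r addrC.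
rewrite scale0r addr0 det_ublock det1 mulr1 => d0.
by apply/matrixP => i j; rewrite !ord1 -[LHS]det_mx11 d0 mxE.
Qed.

Lemma border_mul0 x : x \in U -> ursubmx x *m dlsubmx x = 0.
Proof.
move=> xU; have x0 := border_corner0 xU.
have /(_ 0) : forall t, \det (block_mx 0 (ursubmx x) (dlsubmx x) 1%:M +
   t *: block_mx 0 0 0 (drsubmx x)) = 0.
  apply: det_pencil0 => // t t0.
  have nt0 : t%:R != 0 :> F by have /pcharf0P -> := charF; rewrite -lt0n.
  pose D : 'M[F]_(1 + m) := block_mx (t%:R^-1)%:M 0 0 1%:M.
  rewrite -[RHS](mul0r (\det D)).
  rewrite -(scaled_row nt0 xU) -det_mulmx; congr (\det _).
  rewrite -[X in _ *m (X + _)]submxK x0 /corner !scale_block_mx !add_block_mx.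
  rewrite !mulmx_block.
  rewrite !(mulmx0, mul0mx, mul1mx, mulmx1, addr0, add0r, scaler0).
  rewrite !mul_scalar_mx mul_mx_scalar.
  by rewrite scalerDr !scalerA divff // mulVf // !scale1r addrC.
rewrite scale0r addr0 det_border1 => /eqP; rewrite oppr_eq0 => /eqP d0.
by apply/matrixP => i j; rewrite !ord1 d0 mxE.
Qed.

(** Polarization of [border_mul0]. *)
Lemma off_diag_isotropic w w' : w \in (linfun (@off_diag m) @: U)%VS ->
  w' \in (linfun (@off_diag m) @: U)%VS ->
  w *m block_mx 0 1%:M 1%:M 0 *m w'^T = 0.
Proof.
move=> /memv_imgP [x xU ->] /memv_imgP [y yU ->]; rewrite !lfunE /=.
rewrite /off_diag mul_row_block !(mulmx0, mulmx1, addr0, add0r) tr_row_mx.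
rewrite mul_row_col trmxK -(trmxK (_^T *m _)) trmx_mul !trmxK.
have tr11 (A : 'M[F]_1) : A^T = A by apply/matrixP => i j; rewrite mxE !ord1.
rewrite tr11.
have := border_mul0 (memvD xU yU).
have -> : ursubmx (x + y) = ursubmx x + ursubmx y by rewrite /ursubmx !linearD.
have -> : dlsubmx (x + y) = dlsubmx x + dlsubmx y by rewrite /dlsubmx !linearD.
rewrite mulmxDl !mulmxDr !border_mul0 //.
by rewrite add0r addr0 addrC.
Qed.

(** The dimension of [U] is that of its image by [off_diag] plus the dimension
    [d] of its intersection with the range of [corner]. *)
Lemma border_split : exists2 d,
  (\dim U = d + \dim (linfun (@off_diag m) @: U))%N &
  (d <= m * m)%N /\ (d = m * m -> forall A, corner A \in U)%N.
Proof.
exists (\dim (U :&: lker (linfun (@off_diag m))))%N; first by rewrite limg_ker_dim.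
have dimg : (\dim (limg (linfun (@corner m))) <= m * m)%N.
  have <- : \dim {:'M[F]_m} = (m * m)%N by rewrite dimvf dim_matrix.
  by rewrite -(limg_ker_dim (linfun (@corner m)) fullv) leq_addl.
have sub : (U :&: lker (linfun (@off_diag m)) <= limg (linfun (@corner m)))%VS.
  apply/subvP => x /memv_capP [xU]; rewrite memv_ker lfunE /= => /eqP.
  rewrite /off_diag => H.
  have /eq_row_mx [ux dx] : row_mx (ursubmx x) (dlsubmx x)^T = row_mx 0 0.
    by rewrite H row_mx0.
  apply/memv_imgP; exists (drsubmx x); rewrite ?memvf // lfunE /= /corner.
  rewrite -[LHS]submxK border_corner0 // ux; congr block_mx.
  by rewrite -[LHS]trmxK dx trmx0.
split; first exact: leq_trans (dimvS sub) dimg.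
move=> e A.
have : (limg (linfun (@corner m)) <= U :&: lker (linfun (@off_diag m)))%VS.
  by rewrite -(geq_leqif (dimv_leqif_sup sub)) e.
move/subvP/(_ (corner A)) => H.
have /H : corner A \in limg (linfun (@corner m)).
  by rewrite -[corner A](lfunE (@corner m)) memv_img ?memvf.
by case/memv_capP.
Qed.

Lemma border_dim :
  (\dim U + m.+1 <= m.+1 * m.+1)%N /\
  ((\dim U + m.+1 = m.+1 * m.+1)%N -> forall A, corner A \in U).
Proof.
have [d -> [dm eqd]] := border_split.
have uS : block_mx 0 1%:M 1%:M 0 \in @unitmx F (m + m).
  suff /mulmx1_unit[] : block_mx 0 1%:M 1%:M 0 *m block_mx 0 1%:M 1%:M 0
    = 1%:M :> 'M[F]_(m + m) by [].
  rewrite mulmx_block !(mulmx0, mul0mx, mulmx1, add0r, addr0).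
  by rewrite scalar_mx_block.
have := isotropic_dim uS off_diag_isotropic.
move: (\dim (_ @: U)) => e; rewrite !addnn leq_double => le_e.
have -> : (m.+1 * m.+1 = m * m + m + m.+1)%N.
  by rewrite mulSn mulnS addnC [(m + m * m)%N]addnC.
rewrite leq_add2r leq_add //; split=> // /eqP; rewrite eqn_add2r => /eqP E.
by apply: eqd; apply/eqP; rewrite eqn_leq dm -(leq_add2r m) -E leq_add2l.
Qed.

(** In the case of equality, the lower right block is arbitrary, so that
    [C *m H *m B = 0] for all [H], and one of [C] and [B] is zero. *)
Lemma border_vanish : (forall A, corner A \in U) ->
  forall x, x \in U -> ursubmx x = 0 \/ dlsubmx x = 0.
Proof.
move=> cU x xU; set C := ursubmx x; set B := dlsubmx x.
have CHB0 H : H \in unitmx -> C *m H *m B = 0.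
  move=> uH; have zU : x + corner (invmx H - drsubmx x) \in U by rewrite memvD.
  have := Us zU; rewrite -[X in X + _]submxK border_corner0 // add_block_mx.
  rewrite !addr0 addrC subrK -/C -/B => d0.
  pose D : 'M[F]_(1 + m) := block_mx 1%:M 0 0 H.
  have : \det (block_mx 0 C B (invmx H) *m D) = 0 by rewrite det_mulmx d0 mul0r.
  rewrite mulmx_block !(mulmx0, mul0mx, mulmx1, add0r, addr0) mulVmx //.
  rewrite det_border1 => /eqP; rewrite oppr_eq0 => /eqP e.
  by apply/matrixP => i j; rewrite !ord1 e mxE.
(* [1 + t H] is invertible for some integer [t > 0]. *)
have CEB0 H : C *m H *m B = 0.
  have [q qE] := det_pencil 1%:M H.
  have [|t t0] := @nat_nonroot _ charF q.
    apply/eqP => q0; have /eqP := qE 0.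
    by rewrite q0 horner0 scale0r addr0 det1 eq_sym oner_eq0.
  rewrite qE -unitfE -unitmxE => /CHB0; rewrite mulmxDr mulmxDl CHB0 ?unitmx1 //.
  rewrite add0r -scalemxAr -scalemxAl => /eqP; rewrite scaler_eq0.
  by have /pcharf0P -> := charF; rewrite eqn0Ngt t0 => /eqP.
move: C B CEB0 {CHB0} => C B CEB0.
case: (eqVneq C 0) => [|/rV0Pn [a Ca]]; [by left | right].
apply/colP => b; have /matrixP/(_ 0 0) := CEB0 (delta_mx a b).
rewrite -(mul_delta_mx (0 : 'I_1) a b) mulmxA -colE -mulmxA -rowE.
rewrite !mxE big_ord1 !mxE => /eqP.
by rewrite mulf_eq0 (negPf Ca) => /eqP.
Qed.

Lemma border_equality : (\dim U + m.+1 = m.+1 * m.+1)%N ->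
  (exists2 w : 'rV[F]_(1 + m), w != 0 & forall x, x \in U -> w *m x = 0) \/
  (exists2 u : 'cV[F]_(1 + m), u != 0 & forall x, x \in U -> x *m u = 0).
Proof.
case: border_dim => _ H /H cU; have van := border_vanish cU.
case: (classic (forall x, x \in U -> ursubmx x = 0)) => [C0|nC].
  left; exists (row_mx 1%:M 0).
    by rewrite -row_mx0; apply/eqP => /eq_row_mx [/eqP]; rewrite oner_eq0.
  move=> x xU; rewrite -[x]submxK mul_row_block border_corner0 // C0 //.
  by rewrite !(mulmx0, mul0mx, addr0) row_mx0.
right; exists (col_mx 1%:M 0).
  by rewrite -col_mx0; apply/eqP => /eq_col_mx [/eqP]; rewrite oner_eq0.
(* If [B] is nonzero for [x] and [C] for [y], both are nonzero for [x + y]. *)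
have B0 x : x \in U -> dlsubmx x = 0.
  move=> xU; apply: NNPP => nB; apply: nC => y yU; apply: NNPP => nC.
  have [Cx0|//] := van _ xU; have [//|By0] := van _ yU.
  have uD : ursubmx (x + y) = ursubmx x + ursubmx y by rewrite /ursubmx !linearD.
  have dD : dlsubmx (x + y) = dlsubmx x + dlsubmx y by rewrite /dlsubmx !linearD.
  case: (van _ (memvD xU yU)); first by rewrite uD Cx0 add0r.
  by rewrite dD By0 addr0.
move=> x xU; rewrite -[x]submxK mul_block_col border_corner0 // B0 //.
by rewrite !(mulmx0, mul0mx, addr0) col_mx0.
Qed.

End Bordered.

Lemma rank_corner1 m : \rank (corner (1%:M : 'M[F]_m)) = m.
Proof. by rewrite /corner rank_diag_block_mx mxrank0 mxrank1. Qed.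

(** Matrices of equal rank are equivalent. *)
Lemma same_rank_equiv m n (X Y : 'M[F]_(m, n)) : \rank X = \rank Y ->
  exists L R, [/\ L \in unitmx, R \in unitmx & X = L *m Y *m R].
Proof.
move=> e; have := mulmx_ebase Y; rewrite -e => {e}.
move: (col_ebase_unit Y) (row_ebase_unit Y).
move: (col_ebase Y) (row_ebase Y) => a b ua ub <-.
exists (col_ebase X *m invmx a), (invmx b *m row_ebase X).
split; rewrite ?unitmx_mul ?unitmx_inv ?row_ebase_unit ?col_ebase_unit ?ua ?ub //.
by rewrite !mulmxA mulmxKV // mulmxK // mulmx_ebase.
Qed.

(** Dieudonne's theorem: a linear space of singular matrices has codimension at
    least [n], and in case of equality its elements have a common kernel vector
    on the left or on the right. *)
Lemma singular_space n (U : {vspace 'M[F]_n}) : (0 < n)%N ->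
  (forall x, x \in U -> \det x = 0) ->
  (\dim U + n <= n * n)%N /\
  ((\dim U + n = n * n)%N ->
  (exists2 w : 'rV[F]_n, w != 0 & forall x, x \in U -> w *m x = 0) \/
  (exists2 u : 'cV[F]_n, u != 0 & forall x, x \in U -> x *m u = 0)).
Proof.
case: n U => // m U _.
have [d] := ubnP (m.+1 * m.+1 - \dim U)%N.
elim: d U => // d IHd U; rewrite ltnS => leUd Us.
case: (classic (exists2 J, J \in U & \rank J = m)) => [[J JU rJ]|noJ].
  have [L [R [uL uR JE]]] := same_rank_equiv (etrans rJ (esym (rank_corner1 m))).
  (* Transport [U] so that [J] becomes [corner 1%:M]. *)
  pose g := linfun (mulmxr R \o mulmx L : 'M[F]_(1 + m) -> 'M[F]_(1 + m)).
  have gE x : g x = L *m x *m R by rewrite /g lfunE.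
  pose U' := (g @^-1: U)%VS.
  have memU' x : (x \in U') = (L *m x *m R \in U).
    by rewrite -gE memv_preim.
  have dU : \dim U' = \dim U.
    have kg : (lker g = 0)%VS.
      apply/eqP; rewrite -subv0; apply/subvP => x.
      rewrite memv_ker memv0 gE => /eqP e.
      by rewrite -[x](mulKmx uL) -[L *m x](mulmxK uR) e mul0mx mulmx0.
    rewrite -(limg_dim_eq (f := g)) ?kg ?capv0 // lpreimK //.
    apply/subvP => x _; apply/memv_imgP; exists (invmx L *m x *m invmx R).
      exact: memvf.
    by rewrite gE !mulmxA mulmxV // mul1mx mulmxKV.
  have U's x : x \in U' -> \det x = 0.
    rewrite memU' => /Us/eqP; rewrite !det_mulmx !mulf_eq0.
    move: uL uR; rewrite !unitmxE !unitfE => /negPf -> /negPf ->.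
    by rewrite orbF => /eqP.
  have U'J : corner 1%:M \in U' by rewrite memU' -JE.
  have [dm _] := border_dim U's U'J; rewrite -dU; split=> // e.
  have [[w w0 H]|[u u0 H]] := border_equality U's U'J e; [left|right].
    exists (w *m invmx L).
      by apply: contraNneq w0 => e0; rewrite -[w](mulmxKV uL) e0 mul0mx.
    move=> x xU; have : invmx L *m x *m invmx R \in U'.
      by rewrite memU' !mulmxA mulmxV // mul1mx mulmxKV.
    by move/H; rewrite !mulmxA => /(congr1 (mulmx^~ R)); rewrite mulmxKV ?mul0mx.
  exists (invmx R *m u).
    by apply: contraNneq u0 => e0; rewrite -[u](mulKVmx uR) e0 mulmx0.
  move=> x xU; have : invmx L *m x *m invmx R \in U'.
    by rewrite memU' !mulmxA mulmxV // mul1mx mulmxKV.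
  by move/H; rewrite -!mulmxA => /(congr1 (mulmx L)); rewrite mulKVmx ?mulmx0.
(* Without an element of corank one, a matrix of rank one can be adjoined to
   [U], which is thus not of maximal dimension. *)
have rk x : x \in U -> (\rank x < m)%N.
  move=> xU; rewrite ltn_neqAle; apply/andP; split.
    by apply/eqP => e; apply: noJ; exists x.
  rewrite -ltnS ltn_neqAle rank_leq_row andbT; apply/negP => rx.
  have : x \in unitmx by rewrite -row_free_unit.
  by rewrite unitmxE Us // unitr0.
have [E EU rE] : exists2 E : 'M[F]_m.+1, E \notin U & (\rank E <= 1)%N.
  apply: NNPP => H; have : 1%:M \in U.
    rewrite [1%:M]matrix_sum_delta.
    apply: memv_suml => i _; apply: memv_suml => j _.
    apply: memvZ; apply/negPn/negP => dU; apply: H; exists (delta_mx i j) => //.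
    by rewrite mxrank_delta.
  by move/Us/eqP; rewrite det1 oner_eq0.
have ltU : (\dim U < \dim (U + <[E]>))%N.
  rewrite (ltn_leqif (dimv_leqif_sup (addvSl _ _))).
  apply: contra EU => /subvP; apply.
  exact: subvP (addvSr _ _) _ (memv_line _).
have dM : (\dim (U + <[E]>) <= m.+1 * m.+1)%N.
  have <- : \dim {:'M[F]_m.+1} = (m.+1 * m.+1)%N by rewrite dimvf dim_matrix.
  by rewrite dimvS ?subvf.
have [|x|le _] := IHd (U + <[E]>)%VS.
- by apply: leq_trans leUd; apply: ltn_sub2l => //; apply: leq_trans ltU _.
- move=> /memv_addP [u uU [v /vlineP [t ->] ->]]; apply/eqP/negPn/negP => nz.
  have : u + t *: E \in unitmx by rewrite unitmxE unitfE.
  rewrite -row_free_unit -row_leq_rank leqNgt => /negP; apply.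
  apply: leq_ltn_trans (mxrank_add _ _) _; rewrite -[X in (_ < X)%N]addn1 -addSn.
  by rewrite leq_add ?rk // (leq_trans (mxrank_scale _ _)).
have lt : (\dim U + m.+1 < m.+1 * m.+1)%N.
  by apply: leq_trans le; rewrite ltn_add2r.
by split; [exact: ltnW | move=> e; rewrite e ltnn in lt].
Qed.

End Dieudonne.

(** * Families of subgroups in general position *)

Section Families.
Variable F : fieldType.
Hypothesis charF : [pchar F] =i pred0.

(** If the sets [P c] are in general position, in the sense that every element
    is the sum of an element of all the other ones and of an element of [P c],
    then codimensions add up in any family of subspaces containing their images
    by an additive surjection. *)
Lemma codim_sum (V : vectType F) (G : zmodType) (I : eqType)
    (f : {additive G -> V}) (P : I -> G -> Prop) (U : I -> {vspace V}) :
  (forall v, exists z, f z = v) ->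
  (forall c z, P c z -> f z \in U c) ->
  (forall c z, exists2 y, (forall c', c' != c -> P c' y) & P c (z - y)) ->
  forall s, uniq s ->
  (\dim (\bigcap_(c <- s) U c) + \sum_(c <- s) (dim V - \dim (U c)) = dim V)%N.
Proof.
move=> fsurj PU dec; elim=> [|c s IHs] /= => [_|/andP [cs us]].
  by rewrite !big_nil addn0 dimvf.
rewrite !big_cons; set W := (\bigcap_(c <- s) U c)%VS.
have UW : (U c + W = fullv)%VS.
  apply/eqP; rewrite eqEsubv subvf /=; apply/subvP => v _.
  have [z <-] := fsurj v; have [y yP zy] := dec c z.
  rewrite -(subrK y z) raddfD memv_add ?PU // /W.
  have : {in s, forall c', f y \in U c'}.
    by move=> c' c's; apply/PU/yP; apply: contraNneq cs => <-.
  elim: (s) => [|a l IHl] H; first by rewrite big_nil memvf.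
  rewrite big_cons memv_cap H ?mem_head // IHl // => b bl.
  by rewrite H // in_cons bl orbT.
have := dimv_sum_cap (U c) W; rewrite UW dimvf.
have := IHs us; rewrite -/W.
have : (\dim (U c) <= dim V)%N by rewrite -dimvf dimvS ?subvf.
move: (\dim (_ :&: _)) (\dim (U c)) (\dim W) (dim V) => d a b D.
move: (\sum_(_ <- _) _)%N => e.
move=> le_aD sbD E; apply: (@addnI a).
rewrite addnCA [(a + (_ + e))%N]addnA subnKC // addnA [(d + D)%N]addnC.
by rewrite E -addnA sbD.
Qed.

(** Subgroups in general position that are mapped to singular matrices of size
    [m] by an additive surjection are at most [m] in number; when there are
    exactly [m] of them, their intersection is mapped to [0], and each of their
    images has a common kernel vector on the left or on the right. *)
Lemma singular_family m (G : zmodType) (I : finType)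
    (f : {additive G -> 'M[F]_m}) (P : I -> G -> Prop) (S : {set I}) :
  (0 < m)%N ->
  (forall v, exists z, f z = v) ->
  (forall c, subgroup_pred (P c)) ->
  (forall c z, exists2 y, (forall c', c' != c -> P c' y) & P c (z - y)) ->
  (forall c, c \in S -> forall z, P c z -> \det (f z) = 0) ->
  (#|S| <= m)%N /\
  (#|S| = m ->
     (forall z, (forall c, c \in S -> P c z) -> f z = 0) /\
     (forall c, c \in S ->
       (exists2 w : 'rV[F]_m, w != 0 & forall z, P c z -> w *m f z = 0) \/
       (exists2 u : 'cV[F]_m, u != 0 & forall z, P c z -> f z *m u = 0))).
Proof.
move=> m0 fsurj gP dec Ps.
have /fin_all_exists [U UP] : forall c : I, exists U : {vspace 'M[F]_m},
    (forall z, P c z -> f z \in U) /\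
    (c \in S -> forall x, x \in U -> \det x = 0).
  move=> c; case: (boolP (c \in S)) => cS; last first.
    by exists fullv; split=> // z _; rewrite memvf.
  have [P0 PB] := gP c.
  have [||U [PU Us]] :=
    @singular_span _ charF m (fun x => exists2 z, P c z & x = f z).
  - split; first by exists 0; rewrite ?raddf0.
    move=> _ _ [y Py ->] [z Pz ->].
    by exists (y - z); rewrite ?raddfB //; apply: PB.
  - by move=> _ [z Pz ->]; apply: Ps Pz.
  by exists U; split=> // z Pz; apply: PU; exists z.
have PU c z : P c z -> f z \in U c by case: (UP c) => H _; apply: H.
have dU c : c \in S -> (\dim (U c) + m <= m * m)%N.
  by move=> cS; case: (singular_space charF m0 (proj2 (UP c) cS)).
have := codim_sum fsurj PU dec (enum_uniq S); rewrite dim_matrix.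
rewrite !big_enum /= => D.
have dU' c : c \in S -> (m <= m * m - \dim (U c))%N.
  by move=> cS; rewrite leq_subRL ?dU // (leq_trans _ (dU c cS)) ?leq_addr.
have le_sum : (#|S| * m <= \sum_(c in S) (m * m - \dim (U c)))%N.
  by rewrite -sum_nat_const; apply: leq_sum.
split.
  rewrite -(leq_pmul2r m0) (leq_trans le_sum) // -[X in (_ <= X)%N]D.
  exact: leq_addl.
move=> cardS; rewrite cardS in le_sum.
have sumE : (\sum_(c in S) (m * m - \dim (U c)) = m * m)%N.
  by apply/eqP; rewrite eqn_leq le_sum andbT -[X in (_ <= X)%N]D leq_addl.
split.
  move=> z Pz; apply/eqP; rewrite -memv0.
  have <- : (\bigcap_(c in S) U c = 0)%VS.
    apply/eqP; rewrite -dimv_eq0; move: D; rewrite sumE => /eqP.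
    by rewrite -[X in _ == X]add0n eqn_add2r.
  elim/big_rec: _ => [|c W cS zW]; first exact: memvf.
  by rewrite memv_cap zW andbT; apply/PU/Pz.
move=> c cS; have [_] := singular_space charF m0 (proj2 (UP c) cS).
have dUc : (\dim (U c) + m = m * m)%N.
  have [_] := leqif_sum (fun c cS => leqif_eq (dU' c cS)).
  rewrite sumE sum_nat_const cardS eqxx => /esym/forall_inP/(_ c cS)/eqP e.
  by rewrite [X in (_ + X)%N]e addnC subnK // (leq_trans _ (dU c cS)) ?leq_addr.
case=> // [[w w0 wU]|[u u0 uU]]; [left|right].
  by exists w => // z Pz; apply/wU/PU.
by exists u => // z Pz; apply/uU/PU.
Qed.
End Families.

(** * Singularity preservers of a single matrix algebra *)

Section SingleBlock.
Variable F : fieldType.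
Hypothesis charF : [pchar F] =i pred0.

(** The matrices whose right kernel contains [u]. *)
Definition kills n (u : 'cV[F]_n) (x : 'M[F]_n) : Prop := x *m u = 0.

Lemma kills_subgroup n (u : 'cV[F]_n) : subgroup_pred (kills u).
Proof.
split; first exact: mul0mx.
by move=> x y xu yu; rewrite /kills mulmxBl xu yu subr0.
Qed.

(** The groups [kills u], for [u] in a basis of columns, are in general
    position. *)
Lemma kills_general_position n (B : 'M[F]_n) : B \in unitmx ->
  forall s (z : 'M[F]_n),
  exists2 y, (forall s', s' != s -> kills (col s' B) y) & kills (col s B) (z - y).
Proof.
move=> uB s z; exists (z *m B *m delta_mx s s *m invmx B) => [s' s's|].
  by rewrite /kills colE mulmxA mulmxKV // -mulmxA mul_delta_mx_0 ?mulmx0 // eq_sym.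
rewrite /kills mulmxBl colE [X in _ - X]mulmxA mulmxKV // -[X in _ - X]mulmxA.
by rewrite mul_delta_mx mulmxA subrr.
Qed.

(** Any nonzero column is the first column of an invertible matrix. *)
Lemma col_extend n (u : 'cV[F]_n.+1) : u != 0 ->
  exists2 B : 'M[F]_n.+1, B \in unitmx & col 0 B = u.
Proof.
move=> u0; have ru : \rank u = \rank (delta_mx 0 0 : 'cV[F]_n.+1).
  rewrite mxrank_delta; apply/eqP; rewrite eqn_leq rank_leq_col.
  by rewrite lt0n mxrank_eq0.
have [L [R [uL uR ->]]] := same_rank_equiv ru.
have R0 : R 0 0 != 0 by move: uR; rewrite unitmxE det_mx11 unitfE.
exists (R 0 0 *: L); first by rewrite unitmxZ // unitfE.
by rewrite colE [in RHS](mx11_scalar R) mul_mx_scalar -scalemxAl.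
Qed.

Section Preserver.
Variables (n : nat) (f : {additive 'M[F]_n.+1 -> 'M[F]_n.+1}).
Hypothesis fsurj : forall v, exists z, f z = v.

(** The equality case of [singular_family] for the basis made of the columns of
    an invertible matrix whose first column is [u]. *)
Lemma preserver_kernel : (forall x, \det x = 0 -> \det (f x) = 0) ->
  forall u : 'cV[F]_n.+1, u != 0 ->
  (exists2 w : 'rV[F]_n.+1, w != 0 & forall x, kills u x -> w *m f x = 0) \/
  (exists2 t : 'cV[F]_n.+1, t != 0 & forall x, kills u x -> f x *m t = 0).
Proof.
move=> fs u u0; have [B uB <-] := col_extend u0.
have cB0 s : col s B != 0.
  apply/eqP => e; have := mulKmx uB (delta_mx s (0 : 'I_1)).
  rewrite -colE e mulmx0 => /matrixP/(_ s 0); rewrite !mxE !eqxx => /eqP.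
  by rewrite eq_sym oner_eq0.
have [|||_] := @singular_family _ charF n.+1 _ 'I_n.+1 f
  (fun s => kills (col s B)) setT isT fsurj.
- by move=> s; apply: kills_subgroup.
- exact: kills_general_position uB.
- move=> s _ z zs; apply: fs; apply/eqP/negPn/negP => dz.
  case/eqP: (cB0 s); have uz : z \in unitmx by rewrite unitmxE unitfE.
  by rewrite -[col s B](mulKmx uz) zs mulmx0.
by case=> [|_ /(_ 0 (in_setT _))]; rewrite ?cardsT ?card_ord.
Qed.

(** The side of the kernel vectors does not depend on the column. *)
Lemma preserver_sides : (forall x, \det x = 0 -> \det (f x) = 0) ->
  (forall u : 'cV[F]_n.+1, u != 0 ->
   exists2 t : 'cV[F]_n.+1, t != 0 & forall x, kills u x -> f x *m t = 0) \/
  (forall u : 'cV[F]_n.+1, u != 0 ->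
   exists2 w : 'rV[F]_n.+1, w != 0 & forall x, kills u x -> w *m f x = 0).
Proof.
move=> fs; have ker := preserver_kernel fs.
pose e0 : 'cV[F]_n.+1 := delta_mx 0 0.
have ne0 : e0 != 0.
  by apply/eqP => /matrixP/(_ 0 0)/eqP; rewrite !mxE !eqxx oner_eq0.
(* A column that is not proportional to [e0] is in general position with it. *)
have par (u : 'cV[F]_n.+1) : (exists a, u = a *: e0) \/
    forall z : 'M[F]_n.+1, exists2 y, kills e0 y & kills u (z - y).
  case: (classic (exists2 s, s != 0 & u s 0 != 0)) => [[s s0 us]|H]; [right|left].
    move=> z; exists (z *m u *m ((u s 0)^-1 *: delta_mx 0 s)).
      by rewrite /kills /e0 -mulmxA -scalemxAl mul_delta_mx_0 // scaler0 mulmx0.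
    rewrite /kills mulmxBl -[X in _ - X]mulmxA -scalemxAl -rowE.
    rewrite [row s u]mx11_scalar mxE scale_scalar_mx mulVf //.
    by rewrite mulmx1 subrr.
  exists (u 0 0); apply/colP => s; rewrite !mxE eqxx andbT.
  have [->|s0] := eqVneq s 0; first by rewrite mulr1.
  by rewrite mulr0; apply/eqP/negPn/negP => us; apply: H; exists s.
(* A left and a right kernel vector cannot coexist in general position. *)
have clash (u v : 'cV[F]_n.+1) (w : 'rV[F]_n.+1) (t : 'cV[F]_n.+1) :
    w != 0 -> t != 0 -> (forall x, kills u x -> w *m f x = 0) ->
    (forall x, kills v x -> f x *m t = 0) ->
    ~ forall z, exists2 y, kills u y & kills v (z - y).
  move=> /rV0Pn [a wa] /cV0Pn [b tb] wK tK dec.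
  have [z fz] := fsurj (delta_mx a b); have [y uy vzy] := dec z.
  have : w *m f z *m t = 0.
    rewrite -(subrK y z) raddfD mulmxDr mulmxDl -mulmxA tK // wK //.
    by rewrite mulmx0 mul0mx addr0.
  rewrite fz -(mul_delta_mx (0 : 'I_1) a b) mulmxA -colE -mulmxA -rowE.
  move/matrixP/(_ 0 0)/eqP; rewrite !mxE big_ord1 !mxE mulf_eq0.
  by rewrite (negPf wa) (negPf tb).
have dec_sym u v :
    (forall z : 'M[F]_n.+1, exists2 y, kills u y & kills v (z - y)) ->
    forall z : 'M[F]_n.+1, exists2 y, kills v y & kills u (z - y).
  move=> dec z; have [y uy vy] := dec z; exists (z - y) => //.
  by rewrite opprB addrC subrK.
have killsZ (u : 'cV[F]_n.+1) a :
    a *: u != 0 -> forall x, kills (a *: u) x -> kills u x.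
  rewrite scaler_eq0 negb_or => /andP [a0 _] x; rewrite /kills -scalemxAr => /eqP.
  by rewrite scaler_eq0 (negPf a0) => /eqP.
have [[w0 nw0 K0]|[t0 nt0 K0]] := ker _ ne0; [right|left] => u nu.
- case: (par u) => [[a ua]|dec].
    by exists w0 => // x; rewrite ua => /killsZ ?; apply: K0; rewrite ua in nu; auto.
  have [//|[t nt K]] := ker _ nu.
  by case: (clash _ _ _ _ nw0 nt K0 K).
- case: (par u) => [[a ua]|dec].
    by exists t0 => // x; rewrite ua => /killsZ ?; apply: K0; rewrite ua in nu; auto.
  have [[w nw K]|//] := ker _ nu.
  by case: (clash _ _ _ _ nw nt0 K K0); apply: dec_sym.
Qed.

Lemma sum_col_delta (x : 'M[F]_n.+1) : x = \sum_s col s x *m delta_mx 0 s.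
Proof.
rewrite -[LHS]mulmx1 mx1_sum_delta mulmx_sumr; apply: eq_bigr => s _.
by rewrite colE -mulmxA mul_delta_mx.
Qed.

(** If the vectors [t s] were dependent, then some [f x *m t s], which depends
    on the column [s] of [x] only, would also be a combination of the
    [f x *m t r] with [r != s], and would thus vanish for all [x]. *)
Lemma kernel_vectors_free (t : 'I_n.+1 -> 'cV[F]_n.+1) :
  (forall s, t s != 0) ->
  (forall s x, kills (delta_mx s 0) x -> f x *m t s = 0) ->
  (\matrix_(i, j) t j i 0) \in unitmx.
Proof.
move=> nt tK; set T := \matrix_(i, j) _.
have colT s : col s T = t s by apply/colP => i; rewrite !mxE.
rewrite -unitmx_tr -row_free_unit -kermx_eq0; apply/rowV0P => v /sub_kermxP vT.
apply/rowP => s; rewrite [RHS]mxE; apply/eqP/negPn/negP => vs; case/eqP: (nt s).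
suff H x : f x *m t s = 0 by have [x fx] := fsurj 1%:M; rewrite -[t s]mul1mx -fx H.
pose x' := x *m delta_mx s s.
have -> : f x *m t s = f x' *m t s.
  apply/eqP; rewrite -subr_eq0 -mulmxBl -raddfB tK // /kills mulmxBl -mulmxA.
  by rewrite mul_delta_mx subrr.
have x'0 r : r != s -> f x' *m t r = 0.
  by move=> rs; rewrite tK // /kills -mulmxA mul_delta_mx_0 ?mulmx0 // eq_sym.
apply/colP => i.
have : (f x' *m T *m v^T) i 0 = 0.
  by rewrite -mulmxA -[T]trmxK -trmx_mul vT trmx0 mulmx0 mxE.
rewrite mxE (bigD1 s) //= big1 ?addr0 => [|r rs].
  move/eqP; rewrite [v^T _ _]mxE mulf_eq0 (negPf vs) orbF.
  move=> /eqP e; rewrite [RHS]mxE -[RHS]e -colT colE mulmxA -colE.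
  by rewrite [LHS]mxE.
have /colP/(_ i) := x'0 _ rs; rewrite -colT colE mulmxA -colE mxE => ->.
by rewrite mxE mul0r.
Qed.

(** The case of kernel vectors on the right, where [f] applies the same map to
    all columns up to right multiplication by an invertible matrix. *)
Lemma preserver_columns : (0 < n)%N ->
  (forall u : 'cV[F]_n.+1, u != 0 ->
   exists2 t : 'cV[F]_n.+1, t != 0 & forall x, kills u x -> f x *m t = 0) ->
  exists (s : {rmorphism F -> F}) (P Q : 'M[F]_n.+1),
    [/\ P \in unitmx, Q \in unitmx & forall x, f x = P *m map_mx s x *m Q].
Proof.
move=> n0 fK.
pose d (s : 'I_n.+1) : 'cV[F]_n.+1 := delta_mx s 0.
pose r (s : 'I_n.+1) : 'rV[F]_n.+1 := delta_mx 0 s.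
have rd s : r s *m d s = 1%:M.
  by rewrite mul_delta_mx; apply/matrixP => i j; rewrite !ord1 !mxE !eqxx.
have rd0 s s' : s != s' -> r s *m d s' = 0 by move=> ne; rewrite mul_delta_mx_0.
have nd s : d s != 0.
  by apply/eqP => /matrixP/(_ s 0)/eqP; rewrite !mxE !eqxx oner_eq0.
have /fin_all_exists2 [t nt tK] := fun s => fK (d s) (nd s).
pose T : 'M[F]_n.+1 := \matrix_(i, j) t j i 0.
have uT : T \in unitmx by apply: kernel_vectors_free.
pose u1 : 'cV[F]_n.+1 := const_mx 1.
have ru1 s : r s *m u1 = 1%:M.
  by rewrite -rowE; apply/matrixP => i j; rewrite !ord1 !mxE eqxx.
have [|t1 nt1 t1K] := fK u1.
  by apply/eqP => /matrixP/(_ 0 0)/eqP; rewrite !mxE oner_eq0.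
(* The value of [f x *m t1] only depends on the sum of the columns of [x]. *)
pose g (y : 'cV[F]_n.+1) : 'cV[F]_n.+1 := f (y *m r 0) *m t1.
have gE x : f x *m t1 = g (x *m u1).
  apply/eqP; rewrite -subr_eq0 -mulmxBl -raddfB t1K // /kills mulmxBl.
  by rewrite -[X in _ - X]mulmxA ru1 mulmx1 subrr.
have gsurj v : exists y, g y = v.
  have /cV0Pn [b t1b] := nt1.
  have [x fx] := fsurj (v *m ((t1 b 0)^-1 *: delta_mx 0 b)).
  exists (x *m u1); rewrite -gE fx -mulmxA -scalemxAl -rowE.
  by rewrite [row b t1]mx11_scalar mxE scale_scalar_mx mulVf // mulmx1.
have gB y z : g (y - z) = g y - g z by rewrite /g mulmxBl raddfB mulmxBl.
(* Scaling the columns of [T] so that they add up to [t1] makes [f x *m Q] act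
   by [g] on every column of [x]. *)
pose c := invmx T *m t1; pose Q := T *m diag_mx c^T.
have Qu1 : Q *m u1 = t1.
  rewrite /Q -mulmxA -[RHS](mulKVmx uT); congr (_ *m _).
  by apply/colP => i; rewrite mul_diag_mx !mxE mulr1.
have Qd s : Q *m d s = c s 0 *: t s.
  rewrite /Q -mulmxA; have -> : diag_mx c^T *m d s = c s 0 *: d s.
    apply/colP => i; rewrite mul_diag_mx [LHS]mxE [c^T _ _]mxE !mxE.
    by case: eqP => [->|_] //; rewrite !mulr0.
  by rewrite -scalemxAr -colE; congr (_ *: _); apply/colP => i; rewrite !mxE.
have fQ y s : f (y *m r s) *m Q = g y *m r s.
  have E : f (y *m r s) *m Q = (f (y *m r s) *m Q *m d s) *m r s.
    rewrite [LHS]sum_col_delta (bigD1 s) //= big1 ?addr0; first by rewrite colE.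
    move=> s' ne; rewrite colE -[X in X *m _]mulmxA Qd -scalemxAr tK ?scaler0 ?mul0mx //.
    by rewrite /kills -mulmxA rd0 ?mulmx0 // eq_sym.
  have : f (y *m r s) *m Q *m u1 = g y.
    by rewrite -mulmxA Qu1 gE -mulmxA ru1 mulmx1.
  by rewrite E -mulmxA ru1 mulmx1 => ->.
have hE x : f x *m Q = \sum_s g (col s x) *m r s.
  rewrite {1}[x]sum_col_delta raddf_sum mulmx_suml; apply: eq_bigr => s _.
  by rewrite fQ.
have uQ : Q \in unitmx.
  rewrite unitmx_mul uT unitmxE det_diag unitfE; apply/prodf_neq0 => s _.
  rewrite mxE; apply/eqP => c0; have [y gy] := gsurj (d 0).
  have : f (y *m r s) *m Q *m d s = g y *m r s *m d s by rewrite fQ.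
  rewrite -[f _ *m Q *m _]mulmxA -[g y *m _ *m _]mulmxA Qd c0 scale0r mulmx0.
  rewrite rd mulmx1 gy => /esym/eqP.
  exact/negP/nd.
clearbody Q.
(* [g] is homogeneous: use the kernel vector attached to [d 0 + l *: d 1]. *)
have gl (l : F) : exists m, forall y, g (l *: y) = m *: g y.
  pose o : 'I_n.+1 := lift 0 (Ordinal n0).
  have [|t' nt' t'K] := fK (d 0 + l *: d o).
    apply/eqP => /matrixP/(_ 0 0)/eqP.
    by rewrite !mxE eqxx /= mulr0 addr0 oner_eq0.
  pose e := invmx Q *m t'.
  have fe x : kills (d 0 + l *: d o) x -> f x *m Q *m e = 0.
    by move=> /t'K xK; rewrite /e -mulmxA mulKVmx.
  have re s : r s *m e = (e s 0)%:M by rewrite -rowE [LHS]mx11_scalar mxE.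
  have fQe y k : f (y *m r k) *m Q *m e = e k 0 *: g y.
    by rewrite fQ -[LHS]mulmxA re mul_mx_scalar.
  have e_eq y : e 0 0 *: g (l *: y) = e o 0 *: g y.
    have : f ((l *: y) *m r 0 - y *m r o) *m Q *m e = 0.
      apply: fe; rewrite /kills mulmxBl !mulmxDr -!scalemxAr -!scalemxAl -!mulmxA.
      by rewrite !rd !rd0 // !mulmx0 mulmx1 !scaler0 addr0 add0r subrr.
    rewrite raddfB !mulmxBl !fQe => /eqP.
    by rewrite subr_eq0 => /eqP.
  have e0 : e 0 0 != 0.
    apply/eqP => e00; case/eqP: nt'; rewrite -[t'](mulKVmx uQ) -/e.
    have [y gy] := gsurj (d 0).
    have eo : e o 0 = 0.
      have := e_eq y; rewrite e00 scale0r gy => /esym/eqP.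
      by rewrite scaler_eq0 (negPf (nd 0)) orbF => /eqP.
    have -> : e = 0; last by rewrite mulmx0.
    apply/colP => s; rewrite [RHS]mxE.
    have [->//|s0] := eqVneq s 0; have [->//|so] := eqVneq s o.
    have : f (y *m r s) *m Q *m e = 0.
      apply: fe; rewrite /kills mulmxDr -scalemxAr -!mulmxA !rd0 //.
      by rewrite !mulmx0 scaler0 addr0.
    rewrite fQe gy => /eqP.
    by rewrite scaler_eq0 (negPf (nd 0)) orbF => /eqP.
  exists ((e 0 0)^-1 * e o 0) => y.
  by rewrite -scalerA -e_eq scalerA mulVf // scale1r.
have [y0 gy0] := gsurj (d 0).
(* The homogeneity factor is read off at a vector with [g y0 = d 0]. *)
pose sg (l : F) := (g (l *: y0)) 0 0.
have sgE l y : g (l *: y) = sg l *: g y.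
  have [m mE] := gl l; rewrite mE; congr (_ *: _).
  by rewrite /sg mE gy0 !mxE eqxx mulr1.
have sgB : {morph sg : a b / a - b} by move=> a b; rewrite /sg scalerBl gB !mxE.
have sgM : monoid_morphism sg.
  split; first by rewrite /sg scale1r gy0 mxE eqxx.
  by move=> a b; rewrite {1}/sg -scalerA !sgE gy0 !mxE eqxx mulr1.
pose s : {rmorphism F -> F} := HB.pack sg
  (GRing.isZmodMorphism.Build F F sg sgB)
  (GRing.isMonoidMorphism.Build F F sg sgM).
pose P : 'M[F]_n.+1 := \matrix_(i, j) g (d j) i 0.
have gP y : g y = P *m map_mx s y.
  have -> : g y = \sum_j g (y j 0 *: d j).
    rewrite /g -mulmx_suml -raddf_sum -mulmx_suml; congr (f (_ *m _) *m _).
    rewrite [LHS]matrix_sum_delta; apply: eq_bigr => j _.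
    by rewrite big_ord1.
  apply/colP => i; rewrite summxE [RHS]mxE; apply: eq_bigr => j _.
  by rewrite sgE !mxE mulrC.
exists s, P, (invmx Q); split; rewrite ?unitmx_inv //.
  have /fin_all_exists [y gy] := fun j => gsurj (d j).
  suff /mulmx1_unit[] : P *m (\matrix_(i, j) map_mx s (y j) i 0) = 1%:M by [].
  apply/matrixP => i j; have /colP/(_ i) := gy j; rewrite gP.
  by rewrite /d !mxE eqxx andbT => <-; apply: eq_bigr => k _; rewrite !mxE.
move=> x; rewrite -[LHS](mulmxK uQ); congr (_ *m _); rewrite hE.
rewrite [map_mx s x]sum_col_delta mulmx_sumr; apply: eq_bigr => k _.
by rewrite gP mulmxA map_col.
Qed.

End Preserver.

(** An additive surjection of a matrix algebra of size at least [2] that maps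
    singular matrices to singular matrices is semilinear and equivalent to the
    identity or to the transposition. *)
Lemma singularity_preserver n (f : {additive 'M[F]_n -> 'M[F]_n}) :
  (2 <= n)%N -> (forall v, exists z, f z = v) ->
  (forall x, \det x = 0 -> \det (f x) = 0) ->
  exists (s : {rmorphism F -> F}) (P Q : 'M[F]_n),
    [/\ P \in unitmx, Q \in unitmx &
        (forall x, f x = P *m map_mx s x *m Q) \/
        (forall x, f x = P *m map_mx s x^T *m Q)].
Proof.
case: n f => // n f n1 fsurj fs.
case: (preserver_sides fsurj fs) => K.
  have [s [P [Q [uP uQ fE]]]] := preserver_columns fsurj n1 K.
  by exists s, P, Q; split=> //; left.
pose ft : {additive 'M[F]_n.+1 -> 'M[F]_n.+1} := trmx \o f.
have ftsurj v : exists z, ft z = v.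
  by have [z fz] := fsurj v^T; exists z; rewrite /= fz trmxK.
have [u u0|s [P [Q [uP uQ fE]]]] := preserver_columns ftsurj n1.
  have [w w0 wK] := K u u0; exists w^T => [|x xu].
    by rewrite -(inj_eq (@trmx_inj _ _ _)) trmxK trmx0.
  by rewrite /= -trmx_mul wK ?trmx0.
exists s, Q^T, P^T; rewrite !unitmx_tr; split=> //; right=> x.
by rewrite -[LHS]trmxK -[(f x)^T]/(ft x) fE !trmx_mul map_trmx mulmxA.
Qed.

End SingleBlock.

(** * The algebra of blocks *)

Section Casts.
Variables (F : fieldType) (m m' : nat) (e : m = m').

Lemma castmx_sqM (A B : 'M[F]_m) :
  castmx (e, e) (A *m B) = castmx (e, e) A *m castmx (e, e) B.
Proof. by case: m' / e; rewrite !castmx_id. Qed.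

Lemma castmx_sq_map (s : {rmorphism F -> F}) (A : 'M[F]_m) :
  castmx (e, e) (map_mx s A) = map_mx s (castmx (e, e) A).
Proof. by case: m' / e; rewrite !castmx_id. Qed.

Lemma det_castmx_sq (A : 'M[F]_m) : \det (castmx (e, e) A) = \det A.
Proof. by case: m' / e; rewrite castmx_id. Qed.

Lemma castmx_sq0 : castmx (e, e) (0 : 'M[F]_m) = 0.
Proof. by case: m' / e; rewrite castmx_id. Qed.

Lemma castmx_sqB (A B : 'M[F]_m) :
  castmx (e, e) (A - B) = castmx (e, e) A - castmx (e, e) B.
Proof. by case: m' / e; rewrite !castmx_id. Qed.

End Casts.

Section Blocks.
Variables (F : fieldType) (k : nat) (n : 'I_k -> nat).
Local Notation A := (block_alg F n).

Lemma blockE0 i : (0 : A) i = 0.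
Proof. by rewrite ffunE. Qed.

Lemma blockED (x y : A) i : (x + y) i = x i + y i.
Proof. by rewrite ffunE. Qed.

Lemma blockEB (x y : A) i : (x - y) i = x i - y i.
Proof. by rewrite !ffunE. Qed.

Lemma blockEM (x y : A) i : (x * y) i = x i *m y i.
Proof. by rewrite ffunE. Qed.

Lemma blockE1 i : (1 : A) i = 1%:M.
Proof. by rewrite ffunE. Qed.

(** The projection onto the [j]-th block, as an additive map. *)
Definition block_proj (j : 'I_k) (x : A) : 'M[F]_(n j) := x j.

Fact block_proj_is_zmod_morphism j : zmod_morphism (block_proj j).
Proof. by move=> x y; apply: blockEB. Qed.
HB.instance Definition _ j :=
  GRing.isZmodMorphism.Build A 'M[F]_(n j) (block_proj j)
    (block_proj_is_zmod_morphism j).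

Lemma blockEMn (x : A) t i : (x *+ t) i = x i *+ t.
Proof. exact: (raddfMn (block_proj i)). Qed.

Lemma in_block_eq i (M : 'M[F]_(n i)) : in_block M i = M.
Proof. by rewrite ffunE dfwith_in. Qed.

Lemma in_block_neq i (M : 'M[F]_(n i)) j : i != j -> in_block M j = 0.
Proof. by move=> ne; rewrite ffunE dfwith_out. Qed.

Lemma in_blockB i (M N : 'M[F]_(n i)) :
  in_block (M - N) = in_block M - in_block N.
Proof.
apply/ffunP => j; rewrite blockEB; have [<-|ne] := eqVneq i j.
  by rewrite !in_block_eq.
by rewrite !in_block_neq // subr0.
Qed.

(** Singularity means that some block is a singular matrix. *)
Lemma singularP (x : A) : singular x <-> exists i, \det (x i) = 0.
Proof.
split=> [sx|[i xi] [y [xy _]]].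
  apply: NNPP => nx; apply: sx; exists [ffun i => invmx (x i)].
  have ux i : x i \in unitmx.
    by rewrite unitmxE unitfE; apply/eqP => xi; apply: nx; exists i.
  by split; apply/ffunP => i; rewrite blockEM blockE1 ffunE ?mulmxV ?mulVmx.
have := congr1 (fun z : A => \det (z i)) xy.
by rewrite blockEM blockE1 det1 det_mulmx xi mul0r => /esym/eqP; rewrite oner_eq0.
Qed.

Lemma block_perm_eq (p : 'S_k) (np : forall i, n (p i) = n i) j
    (M : 'M[F]_(n (p j))) :
  block_perm np (in_block M) j = castmx (np j, np j) M.
Proof. by rewrite ffunE in_block_eq. Qed.

Lemma block_perm_neq (p : 'S_k) (np : forall i, n (p i) = n i) i
    (M : 'M[F]_(n i)) j : i != p j -> block_perm np (in_block M) j = 0.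
Proof. by move=> ne; rewrite ffunE in_block_neq // castmx_sq0. Qed.

(** The elements whose [i]-th block has [u] in its right kernel. *)
Definition block_kills i (u : 'cV[F]_(n i)) (x : A) : Prop := x i *m u = 0.

Lemma block_kills_subgroup i (u : 'cV[F]_(n i)) : subgroup_pred (block_kills u).
Proof.
split; first by rewrite /block_kills blockE0 mul0mx.
by move=> x y xu yu; rewrite /block_kills blockEB mulmxBl xu yu subr0.
Qed.

Lemma block_kills_singular i (u : 'cV[F]_(n i)) x :
  u != 0 -> block_kills u x -> singular x.
Proof.
move=> u0 xu; apply/singularP; exists i; apply/eqP/negPn/negP => dx.
have ux : x i \in unitmx by rewrite unitmxE unitfE.
by case/eqP: u0; rewrite -[u](mulKmx ux) xu mulmx0.
Qed.

(** The pairs of a block and of a column index in this block. *)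
Definition block_index : finType := {i : 'I_k & 'I_(n i)}.

(** The columns of a family [B] of square matrices, one for each block. *)
Definition block_col (B : forall i, 'M[F]_(n i)) (c : block_index) :=
  col (tagged c) (B (tag c)).

Lemma block_general_position (B : forall i, 'M[F]_(n i)) :
  (forall i, B i \in unitmx) -> forall (c : block_index) (z : A),
  exists2 y, (forall c', c' != c -> block_kills (block_col B c') y) &
             block_kills (block_col B c) (z - y).
Proof.
move=> uB [i s] z; have [y yK zyK] := kills_general_position (uB i) s (z i).
exists (in_block y) => [[i' s'] ne|]; rewrite /block_kills /block_col /=.
  have [e|nei] := eqVneq i i'; last by rewrite in_block_neq // mul0mx.
  case: i' / e s' ne => s' ne; rewrite in_block_eq.
  by apply: yK; apply: contraNneq ne => ->.
by rewrite blockEB in_block_eq.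
Qed.

Lemma card_block_index : #|block_index| = (\sum_i n i)%N.
Proof.
rewrite card_tagged sumnE big_map big_enum /=.
by apply: eq_bigr => i _; rewrite card_ord.
Qed.

Lemma card_block i : #|[set c : block_index | tag c == i]| = n i.
Proof.
rewrite -[RHS]card_ord.
rewrite -(card_imset (mem 'I_(n i)) (f := Tagged (fun i => 'I_(n i)))).
  apply: eq_card => -[i' s]; rewrite !inE /=; apply/eqP/imsetP => [e|[t _ e]].
    by case: i / e; exists s.
  by have := congr1 tag e.
by move=> s t /eqP; rewrite eq_Tagged => /eqP.
Qed.

End Blocks.

(** * The target of a block *)

Section BlockPreserver.
Variables (F : fieldType) (k : nat) (n : 'I_k -> nat).
Hypothesis charF : [pchar F] =i pred0.
Hypothesis n_gt0 : forall i, (0 < n i)%N.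
Local Notation A := (block_alg F n).

(** A group of singular elements is singular in one and the same block. *)
Lemma singular_group_block (P : A -> Prop) :
  subgroup_pred P -> (forall x, P x -> singular x) ->
  exists j, forall x, P x -> \det (x j) = 0.
Proof.
move=> gP Ps; apply: NNPP => nj.
have Pj j : exists2 x, P x & \det (x j) != 0.
  apply: NNPP => H; apply: nj; exists j => x Px.
  by apply/eqP/negPn/negP => dx; apply: H; exists x.
(* Given [y] and [x] in [P] such that [y] is nonsingular in the blocks of [s]
   and [x] in the block [j], so is [y + t (x - y)] in all of them for some
   integer [t]. *)
have Pall (s : seq 'I_k) : exists2 x, P x & forall j, j \in s -> \det (x j) != 0.
  elim: s => [|j s [y Py ys]]; first by exists 0 => //; case: gP.
  have [x Px xj] := Pj j.
  have /fin_all_exists [q qE] := fun l => det_pencil (y l) ((x - y) l).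
  have : \prod_(l <- j :: s) q l != 0.
    rewrite prodf_seq_neq0; apply/allP => l; rewrite in_cons /=.
    case/orP => [/eqP -> | ls]; apply/eqP => q0.
      have := qE j 1; rewrite q0 horner0 scale1r blockEB addrC subrK => /esym/eqP.
      exact/negP.
    have := qE l 0; rewrite q0 horner0 scale0r addr0 => /esym/eqP.
    exact/negP/ys.
  case/(nat_nonroot charF) => t _; rewrite horner_prod prodf_seq_neq0 => /allP qt.
  exists (y + (x - y) *+ t).
    apply: subgroup_predD => //; apply: subgroup_predMn => //.
    by case: gP => _; apply.
  by move=> l /qt /=; rewrite qE => qt0; rewrite blockED blockEMn -scaler_nat.
have [x Px xs] := Pall (enum 'I_k).
have /singularP [i /eqP] := Ps x Px.
by apply/negP/xs; rewrite mem_enum.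
Qed.

Variable Phi : {additive A -> A}.
Hypothesis Phi_surj : forall y, exists x, Phi x = y.

Lemma Phi_block_surj j (v : 'M[F]_(n j)) : exists z, (block_proj j \o Phi) z = v.
Proof.
have [z zE] := Phi_surj (in_block v); exists z.
by rewrite /= zE /block_proj in_block_eq.
Qed.

Section Singular.
Hypothesis Phi_sing : forall x : A, singular x -> singular (Phi x).

(** The target [j] of a column [u] of the [i]-th block. *)
Lemma kills_target i (u : 'cV[F]_(n i)) : u != 0 ->
  exists j, forall x, block_kills u x -> \det (Phi x j) = 0.
Proof.
move=> u0; have [P0 PB] := block_kills_subgroup u.
have [||j jP] :=
  @singular_group_block (fun y => exists2 x, block_kills u x & y = Phi x).
- split; first by exists 0; rewrite ?raddf0.
  by move=> _ _ [x xu ->] [y yu ->]; exists (x - y); rewrite ?raddfB //; apply: PB.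
- by move=> _ [x xu ->]; apply/Phi_sing/block_kills_singular/xu.
by exists j => x xu; apply: jP; exists x.
Qed.

(** For any choice [J] of targets of the columns of a family of bases, each
    block is the target of as many columns as its size, and the corresponding
    component of [Phi x] depends on the product of [x] with these columns
    only. *)
Lemma target_count (B : forall i, 'M[F]_(n i)) (J : block_index n -> 'I_k) :
  (forall i, B i \in unitmx) ->
  (forall c x, block_kills (block_col B c) x -> \det (Phi x (J c)) = 0) ->
  forall j, #|[set c | J c == j]| = n j /\
    forall x, (forall c, J c = j -> block_kills (block_col B c) x) -> Phi x j = 0.
Proof.
move=> uB JP.
have fam j := @singular_family _ charF (n j) _ (block_index n)
  (block_proj j \o Phi) (fun c => block_kills (block_col B c))
  [set c | J c == j] (n_gt0 j) (@Phi_block_surj j)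
  (fun c => block_kills_subgroup _) (block_general_position uB).
have {}fam j : (#|[set c | J c == j]| <= n j)%N /\
    (#|[set c | J c == j]| = n j -> forall x,
      (forall c, J c = j -> block_kills (block_col B c) x) -> Phi x j = 0).
  case: (fam j) => [c|le H]; first by rewrite inE => /eqP <-; apply: JP.
  split=> // /H [K _] x xK; apply: K => c; rewrite inE => /eqP; exact: xK.
(* The number of columns is both the sum of these cardinals and that of the
   bounds [n j]. *)
have cardE : forall j, #|[set c | J c == j]| = n j.
  have [_] := leqif_sum (fun j (_ : true) => leqif_eq (proj1 (fam j))).
  have -> : (\sum_j #|[set c | J c == j]| = \sum_j n j)%N.
    rewrite -(card_block_index n) -sum1_card (partition_big J xpredT) //=.
    apply: eq_bigr => j _; rewrite -sum1_card.
    by apply: eq_bigl => c; rewrite inE.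
  by rewrite eqxx => /esym/forallP H j; apply/eqP/H.
by move=> j; split; [|apply: (proj2 (fam j))].
Qed.

(** A target of the sum of two columns [s] and [t] of the standard basis of a
    block is the target of [s], because the column [s] can be replaced by this
    sum without changing the count of [target_count]. *)
Lemma target_exchange (J : block_index n -> 'I_k) i (s t : 'I_(n i)) j :
  (forall c x, block_kills (block_col (fun i => 1%:M) c) x ->
     \det (Phi x (J c)) = 0) ->
  s != t ->
  (forall x, block_kills (delta_mx s 0 + delta_mx t 0 : 'cV[F]_(n i)) x ->
     \det (Phi x j) = 0) ->
  J (Tagged _ s) = j.
Proof.
move=> JP st jP; apply/eqP/negPn/negP => Jj.
pose cs : block_index n := Tagged _ s.
pose B := dfwith (fun i => 1%:M : 'M[F]_(n i)) (1%:M + delta_mx t s : 'M[F]_(n i)).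
pose J' c := if c == cs then j else J c.
have uB i' : B i' \in unitmx.
  rewrite /B; case: dfwithP => [|i'' _]; last exact: unitmx1.
  have /mulmx1_unit[] // :
    (1%:M + delta_mx t s) *m (1%:M - delta_mx t s) = 1%:M :> 'M[F]_(n i).
  by rewrite mulmxDl mul1mx mulmxBr mulmx1 mul_delta_mx_0 // subr0 subrK.
have J'P c x : block_kills (block_col B c) x -> \det (Phi x (J' c)) = 0.
  rewrite /J'; have [->|] := eqVneq c cs.
    rewrite /block_col /B /= dfwith_in => xK; apply: jP.
    by rewrite colE mulmxDl mul1mx mul_delta_mx in xK.
  case: c => i' s' ne xK; apply: JP; move: xK.
  rewrite /block_col /B /=.
  have [e|nei] := eqVneq i i'; last by rewrite dfwith_out.
  case: i' / e s' ne => s' ne.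
  rewrite dfwith_in !colE mulmxDl mul_delta_mx_0 ?addr0 //.
  by rewrite eq_sym; apply: contraNneq ne => ->.
have [cardJ _] := target_count (fun i => unitmx1 _ _) JP (J cs).
have [cardJ' _] := target_count uB J'P (J cs).
suff : (#|[set c | J' c == J cs]| < #|[set c | J c == J cs]|)%N.
  by rewrite cardJ cardJ' ltnn.
apply/proper_card/properP; split; last first.
  by exists cs; rewrite !inE // /J' eqxx eq_sym.
apply/subsetP => c; rewrite !inE /J'; have [->|//] := eqVneq c cs.
by rewrite eqxx.
Qed.

(** Every block [j] of the image depends on a single block [p j], of the same
    size. *)
Lemma block_structure : exists p : 'S_k,
  (forall j, n (p j) = n j) /\ forall j (x : A), x (p j) = 0 -> Phi x j = 0.
Proof.
have /fin_all_exists [J JP] : forall c : block_index n, exists j, forall x : A,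
    block_kills (block_col (fun i => 1%:M) c) x -> \det (Phi x j) = 0.
  move=> [i s]; apply: kills_target; rewrite /block_col colE mul1mx.
  by apply/eqP => /matrixP/(_ s 0)/eqP; rewrite !mxE !eqxx oner_eq0.
have Jst i (s t : 'I_(n i)) : J (Tagged _ s) = J (Tagged _ t).
  have [->//|st] := eqVneq s t.
  have [|j jP] := @kills_target i (delta_mx s 0 + delta_mx t 0).
    apply/eqP => /matrixP/(_ s 0)/eqP.
    by rewrite !mxE !eqxx (negPf st) addr0 oner_eq0.
  rewrite (target_exchange JP st jP) (@target_exchange J i t s j) // 1?eq_sym //.
  by move=> x; rewrite addrC; apply: jP.
have cnt := target_count (fun i => unitmx1 _ _) JP.
pose q i := J (Tagged _ (Ordinal (n_gt0 i))).
have Jq c : J c = q (tag c) by case: c => i s; apply: Jst.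
(* [q i] is the common target of the columns of the block [i]; it is onto
   because [n j > 0], and [p] is its inverse. *)
have /fin_all_exists [p0 qp0] : forall j, exists i, q i = j.
  move=> j; have : (0 < #|[set c | J c == j]|)%N by rewrite (cnt j).1.
  by case/card_gt0P => c; rewrite inE Jq => /eqP; exists (tag c).
pose p := perm (can_inj qp0).
have qp i : q i = (p^-1)%g i by rewrite -{1}[i](permKV p) permE qp0.
have Jp c j : (J c == j) = (tag c == p j).
  by rewrite Jq qp; apply/eqP/eqP => [<-|->]; rewrite ?permK ?permKV.
exists p; split=> [j|j x xpj].
  rewrite -(cnt j).1 -card_block; apply: eq_card => c.
  by rewrite !inE Jp.
apply: (cnt j).2 => c /eqP; rewrite Jp => /eqP e.
have x0 : x (tag c) = 0 by rewrite e.
by rewrite /block_kills x0 mul0mx.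
Qed.

End Singular.
End BlockPreserver.

(** * Maps permuting the blocks *)

Section BlockMaps.
Variables (F : fieldType) (k : nat) (n : 'I_k -> nat).
Hypothesis charF : [pchar F] =i pred0.
Hypothesis n_gt0 : forall i, (0 < n i)%N.
Local Notation A := (block_alg F n).
Variable Phi : {additive A -> A}.

Section Compression.
Variables (p : 'S_k) (np : forall i, n (p i) = n i) (j : 'I_k).

(** The component of [Phi] from the block [p j] to the block [j], which has the
    same size; the cast makes it an endomorphism of ['M_(n (p j))]. *)
Definition block_component (M : 'M[F]_(n (p j))) : 'M[F]_(n (p j)) :=
  castmx (esym (np j), esym (np j)) (Phi (in_block M) j).

Fact block_component_is_zmod_morphism : zmod_morphism block_component.
Proof.
by move=> M N; rewrite /block_component in_blockB raddfB blockEB castmx_sqB.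
Qed.
HB.instance Definition _ :=
  GRing.isZmodMorphism.Build 'M[F]_(n (p j)) 'M[F]_(n (p j)) block_component
    block_component_is_zmod_morphism.

Lemma block_componentE M :
  Phi (in_block M) j = castmx (np j, np j) (block_component M).
Proof. by rewrite /block_component castmxKV. Qed.

End Compression.

Lemma Phi_in_block_local (p : 'S_k) :
  (forall j (x : A), x (p j) = 0 -> Phi x j = 0) ->
  (forall j (x : A), Phi x j = Phi (in_block (x (p j))) j) /\
  (forall i (M : 'M[F]_(n i)) j, i != p j -> Phi (in_block M) j = 0).
Proof.
move=> loc; split=> [j x|i M j ne]; last by apply: loc; rewrite in_block_neq.
apply/eqP; rewrite -subr_eq0 -blockEB -raddfB; apply/eqP/loc.
by rewrite blockEB in_block_eq subrr.
Qed.

Lemma block_image (p : 'S_k) (np : forall i, n (p i) = n i) :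
  (forall y, exists x, Phi x = y) ->
  (forall j (x : A), x (p j) = 0 -> Phi x j = 0) ->
  forall (i : 'I_k) (y : A),
    (exists2 x, is_block i x & y = Phi x) <->
    (exists2 x, is_block i x & y = block_perm np x).
Proof.
move=> Phi_surj loc i y; have [PhiE Phi0] := Phi_in_block_local loc.
rewrite -(permKV p i); set j := (p^-1)%g i; split=> [[_ [M ->] ->]|[_ [M ->] ->]].
  exists (in_block (block_component np M)); first by eexists.
  apply/ffunP => j'; have [->|ne] := eqVneq j' j.
    by rewrite block_perm_eq block_componentE.
  have ne' : p j != p j' by rewrite (inj_eq perm_inj) eq_sym.
  by rewrite block_perm_neq // Phi0.
have [x xE] := Phi_surj (block_perm np (in_block M)).
exists (in_block (x (p j))); first by eexists.
apply/ffunP => j'; have [->|ne] := eqVneq j' j; first by rewrite -PhiE xE.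
have ne' : p j != p j' by rewrite (inj_eq perm_inj) eq_sym.
by rewrite block_perm_neq // Phi0.
Qed.

(** The equation in the algebra describing [Phi] on a block, in terms of
    matrices. *)
Lemma block_formula (p : 'S_k) (np : forall i, n (p i) = n i) j
    (s : {rmorphism F -> F}) (P Q M : 'M[F]_(n (p j))) (y : A) :
  (y = block_perm np (in_block P) * block_map s (block_perm np (in_block M))
       * block_perm np (in_block Q)) <->
  (y j = castmx (np j, np j) (P *m map_mx s M *m Q) /\
   forall j', j' != j -> y j' = 0).
Proof.
set z := RHS.
have zj : z j = castmx (np j, np j) (P *m map_mx s M *m Q).
  rewrite /z !blockEM !block_perm_eq [block_map _ _ j]ffunE block_perm_eq.
  by rewrite !castmx_sqM castmx_sq_map.
have z0 j' : j' != j -> z j' = 0.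
  move=> ne; have ne' : p j != p j' by rewrite (inj_eq perm_inj) eq_sym.
  by rewrite /z !blockEM !block_perm_neq // mulmx0.
split=> [-> //|[yj y0]]; apply/ffunP => j'.
have [->|ne] := eqVneq j' j; first by rewrite yj zj.
by rewrite y0 // z0.
Qed.

Lemma block_semilinear (p : 'S_k) (np : forall i, n (p i) = n i) j :
  (forall y, exists x, Phi x = y) ->
  (forall x, singular x -> singular (Phi x)) ->
  (forall j (x : A), x (p j) = 0 -> Phi x j = 0) ->
  (2 <= n (p j))%N ->
  exists (s : {rmorphism F -> F}) (P Q : 'M[F]_(n (p j))),
    [/\ P \in unitmx, Q \in unitmx &
      (forall M, Phi (in_block M) j = castmx (np j, np j) (P *m map_mx s M *m Q))
      \/
      (forall M,
         Phi (in_block M) j = castmx (np j, np j) (P *m map_mx s M^T *m Q))].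
Proof.
move=> Phi_surj Phi_sing loc n2; have [PhiE Phi0] := Phi_in_block_local loc.
have surj v : exists z, block_component np z = v :> 'M_(n (p j)).
  have [x xE] := Phi_surj (in_block (castmx (np j, np j) v)).
  exists (x (p j)); rewrite /block_component -PhiE xE in_block_eq.
  by rewrite castmxK.
have sing (M : 'M_(n (p j))) : \det M = 0 -> \det (block_component np M) = 0.
  move=> dM; rewrite /block_component det_castmx_sq.
  (* Replace the block [p j] of a preimage of [1] by [M]. *)
  have [z zE] := Phi_surj 1.
  pose x := z + in_block (M - z (p j)).
  have xj : x (p j) = M by rewrite /x blockED in_block_eq addrC subrK.
  have /Phi_sing/singularP [j' dj'] : singular x.
    by apply/singularP; exists (p j); rewrite xj.
  have [ej|ne] := eqVneq j' j; first by rewrite -xj -PhiE -ej.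
  have ne' : p j != p j' by rewrite (inj_eq perm_inj) eq_sym.
  move/eqP: dj'; rewrite /x raddfD blockED zE Phi0 // addr0 blockE1 det1.
  by rewrite oner_eq0.
have [s [P [Q [uP uQ H]]]] :=
  singularity_preserver charF (f := block_component np (j := j)) n2 surj sing.
exists s, P, Q; split=> //.
by case: H => H; [left|right] => M; rewrite block_componentE H.
Qed.

Lemma blockwise_singular (p : 'S_k) (np : forall i, n (p i) = n i) :
  (forall (i : 'I_k) (y : A), (exists2 x, is_block i x & y = Phi x) ->
     (exists2 x, is_block i x & y = block_perm np x)) ->
  (forall j, (2 <= n (p j))%N -> forall M : 'M[F]_(n (p j)),
     \det M = 0 -> \det (Phi (in_block M) j) = 0) ->
  forall x, singular x -> singular (Phi x).
Proof.
move=> img sing x /singularP [i xi]; apply/singularP.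
move: i xi => i0; rewrite -(permKV p i0); move: ((p^-1)%g i0) => j dx; exists j.
have Phi0 i (M : 'M[F]_(n i)) : i != p j -> Phi (in_block M) j = 0.
  move=> ne; have [|_ [N ->] ->] := img i (Phi (in_block M)).
    by exists (in_block M); first by eexists.
  by rewrite block_perm_neq.
have xE : x = \sum_i in_block (x i).
  apply/ffunP => i; rewrite -[RHS]/(block_proj i _) raddf_sum (bigD1 i) //= big1.
    by rewrite addr0 /block_proj in_block_eq.
  by move=> i' ne; rewrite /block_proj in_block_neq.
rewrite xE raddf_sum -/(block_proj j _) raddf_sum (bigD1 (p j)) //= big1 ?addr0.
  have [n2|n1] := leqP 2 (n (p j)); first exact: sing.
  suff x0 : x (p j) = 0.
    have -> : in_block (x (p j)) = 0 :> A.
      apply/ffunP => i; rewrite blockE0; have [<-|ne] := eqVneq (p j) i.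
        by rewrite in_block_eq.
      by rewrite in_block_neq.
    rewrite raddf0 /block_proj blockE0 -(prednK (n_gt0 j)); exact: det0.
  have n1' : n (p j) = 1%N by apply/eqP; rewrite eqn_leq n_gt0 -ltnS n1.
  move: (x (p j)) dx; rewrite n1' => M; rewrite det_mx11 => M0.
  by apply/matrixP => a b; rewrite !ord1 M0 mxE.
by move=> i ne; rewrite /block_proj Phi0.
Qed.

End BlockMaps.

Theorem theorem1p4 (F : fieldType) (charF : [pchar F] =i pred0)
    (k : nat) (k_gt0 : (0 < k)%N)
    (n : 'I_k -> nat) (n_gt0 : forall i, (0 < n i)%N)
    (Phi : {additive block_alg F n -> block_alg F n})
    (Phi_surj : forall y : block_alg F n, exists x : block_alg F n, Phi x = y) :
  (forall x : block_alg F n, singular x -> singular (Phi x))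
  <->
  (exists (p : 'S_k) (np : forall i, n (p i) = n i),
     (forall (i : 'I_k) (y : block_alg F n),
        (exists2 x, is_block i x & y = Phi x) <->
        (exists2 x, is_block i x & y = block_perm np x))
     /\
     (forall i : 'I_k, (2 <= n i)%N ->
        exists (s : {rmorphism F -> F}) (P Q : 'M[F]_(n i)),
          [/\ P \in unitmx, Q \in unitmx &
            (forall M : 'M[F]_(n i),
               Phi (in_block M) =
                 block_perm np (in_block P)
                 * block_map s (block_perm np (in_block M))
                 * block_perm np (in_block Q))
            \/
            (forall M : 'M[F]_(n i),
               Phi (in_block M) =
                 block_perm np (in_block P)
                 * block_map s (block_perm np (in_block M^T))
                 * block_perm np (in_block Q))])).
Proof.
split=> [Phi_sing|[p [np [img form]]]].
  have [p [np loc]] := block_structure charF n_gt0 Phi_surj Phi_sing.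
  have [PhiE Phi0] := Phi_in_block_local loc.
  exists p, np; split; first exact: block_image.
  move=> i; rewrite -(permKV p i); move: ((p^-1)%g i) => j n2.
  have [s [P [Q [uP uQ H]]]] :=
    block_semilinear charF np Phi_surj Phi_sing loc n2.
  have off (M : 'M[F]_(n (p j))) j' : j' != j -> Phi (in_block M) j' = 0.
    by move=> ne; apply: Phi0; rewrite (inj_eq perm_inj) eq_sym.
  exists s, P, Q; split=> //.
  case: H => H; [left|right] => M; apply/block_formula; split=> //; exact: off.
apply: (blockwise_singular n_gt0 (p := p) (np := np)) => [i y|j n2 M dM].
  by case: (img i y).
have [s [P [Q [_ _ [H|H]]]]] := form (p j) n2.
  have [-> _] := (block_formula np s P Q M _).1 (H M).
  by rewrite det_castmx_sq !det_mulmx det_map_mx dM rmorph0 mulr0 mul0r.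
have [-> _] := (block_formula np s P Q M^T _).1 (H M).
by rewrite det_castmx_sq !det_mulmx det_map_mx det_tr dM rmorph0 mulr0 mul0r.
Qed.
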